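(* Let $\gamma$ be an anisotropic surface energy with Fourier expansion $\gamma(\theta)=\frac{a_0}{2}+\sum_{l=1}^\infty[a_l\cos(l\theta)+b_l\sin(l\theta)]$, $-\pi\le\theta\le\pi$, where $a_l=\frac1\pi\int_{-\pi}^{\pi}\gamma(\theta)\cos(l\theta)\,d\theta$ and $b_l=\frac1\pi\int_{-\pi}^{\pi}\gamma(\theta)\sin(l\theta)\,d\theta$. Assume $$\frac{a_0}{2}\ge\sum_{l=1}^\infty(1+l^2)\sqrt{a_l^2+b_l^2}.$$ Then $$2\gamma(\theta)-\gamma(\theta)\cos(\theta-\phi)-\gamma'(\theta)\sin(\theta-\phi)\ge\gamma(\phi),\qquad\forall\,\theta,\phi\in[-\pi,\pi],$$ and thus the ES-PFEM is unconditionally energy stable: for any $\tau>0$, if $(\mathbf X^{m+1},\mu^{m+1})\in\mathbb X_p^h\times\mathbb K_p^h$, $m\ge0$, satisfy for every $m\ge0$ $$\Big(\frac{\mathbf X^{m+1}-\mathbf X^m}{\tau},\varphi^h\mathbf n^m\Big)^h_{\Gamma^m}+\big(\partial_s\mu^{m+1},\partial_s\varphi^h\big)^h_{\Gamma^m}=0\quad\forall\varphi^h\in\mathbb K_p^h,$$ $$\big(\mu^{m+1},\mathbf n^m\cdot\boldsymbol\omega^h\big)^h_{\Gamma^m}-\big(G(\theta^m)\partial_s\mathbf X^{m+1},\partial_s\boldsymbol\omega^h\big)^h_{\Gamma^m}=0\quad\forall\boldsymbol\omega^h\in\mathbb X_p^h,$$ starting from a given $\mathbf X^0\in\mathbb X_p^h$,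 then $W_c^m:=\sum_{j=1}^N|\mathbf h_j^m|\,\gamma(\theta_j^m)$ satisfies $W_c^{m+1}\le W_c^m\le\dots\le W_c^0$ for all $m\ge0$.
   Context: A surface energy is a positive function $\gamma\in C^1([-\pi,\pi])$ with $\gamma(-\pi)=\gamma(\pi)$. $G(\theta)=\begin{pmatrix}\gamma(\theta)&-\gamma'(\theta)\\ \gamma'(\theta)&\gamma(\theta)\end{pmatrix}$. For $\mathbf v=(v_1,v_2)^T$, $\mathbf v^\perp=(v_2,-v_1)^T$. Let $N\ge3$ be an integer, $h=1/N$, $\rho_j=jh$ ($0\le j\le N$), $I_j=[\rho_{j-1},\rho_j]$. $\mathbb K_p^h$ is the space of continuous functions $u^h$ on $[0,1]$ which are affine on each $I_j$ and satisfy $u^h(0)=u^h(1)$; $\mathbb X_p^h=\mathbb K_p^h\times\mathbb K_p^h$. For each $m$, $\mathbf h_j^m=(h^m_{j,x},h^m_{j,y})^T=\mathbf X^m(\rho_j)-\mathbf X^m(\rho_{j-1})$, assumed nonzero for all $j$ and $m$ (so that the following are defined): the normal $\mathbf n^m$ is constant on $I_j$ with value $-(\mathbf h_j^m)^\perp/|\mathbf h_j^m|$, and $\theta^m|_{I_j}=\theta_j^m\in[-\pi,\pi]$ satisfies $\cos\theta_j^m=h^m_{j,x}/|\mathbf h_j^m|$, $\sin\theta_j^m=h^m_{j,y}/|\mathbf h_j^m|$. On $\Gamma^m$, for $f$ affine on each $I_j$ (including $f=\mathbf X^{m+1}$), $\partial_s f|_{I_j}=\big(f(\rho_j)-f(\rho_{j-1})\big)/|\mathbf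 h_j^m|$. The mass-lumped inner product is $(u,v)^h_{\Gamma^m}=\frac12\sum_{j=1}^N|\mathbf h_j^m|\big[(u\cdot v)(\rho_j^-)+(u\cdot v)(\rho_{j-1}^+)\big]$, with one-sided limits at the nodes. *)

(* Defs.v *)
From mathcomp Require Import all_boot all_order all_algebra.
From mathcomp Require Import all_classical all_reals all_analysis.
Import Order.TTheory GRing.Theory Num.Theory.
Import numFieldNormedType.Exports.

Set Implicit Arguments.
Unset Strict Implicit.
Unset Printing Implicit Defensive.

Local Open Scope classical_set_scope.
Local Open Scope ring_scope.

(* Surface energies are functions on [-pi, pi]; they are represented by total
   functions whose values outside that interval are never used. *)

Section SurfaceEnergy.
Variable R : realType.
Implicit Types gamma dgamma : R -> R.

(* At the endpoints a and b the limit is the one-sided derivative. *)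
Definition is_derivative_on (a b : R) (f df : R -> R) : Prop :=
  forall x, a <= x <= b ->
    (f y - f x) / (y - x) @[y --> within `[a, b] x^'] --> df x.

(* gamma is a positive C^1 function on [-pi, pi] with matching end values, and
   dgamma is its derivative; no condition is put on dgamma (- pi) and
   dgamma pi. *)
Definition surface_energy gamma dgamma : Prop :=
  [/\ forall x, - pi <= x <= pi -> 0 < gamma x,
      is_derivative_on (- pi) pi gamma dgamma,
      {within `[- pi, pi], continuous dgamma} &
      gamma (- pi) = gamma pi].

Definition fourier_cos gamma (l : nat) : R :=
  pi^-1 * \int[lebesgue_measure]_(x in `[- pi, pi]) (gamma x * cos (l%:R * x)).

Definition fourier_sin gamma (l : nat) : R :=
  pi^-1 * \int[lebesgue_measure]_(x in `[- pi, pi]) (gamma x * sin (l%:R * x)).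

Definition fourier_partial_sum gamma (n : nat) (x : R) : R :=
  fourier_cos gamma 0 / 2 +
  \sum_(1 <= l < n.+1) (fourier_cos gamma l * cos (l%:R * x) +
                        fourier_sin gamma l * sin (l%:R * x)).

Definition has_fourier_expansion gamma : Prop :=
  forall x, - pi <= x <= pi ->
    fourier_partial_sum gamma n x @[n --> \oo] --> gamma x.

End SurfaceEnergy.

Section Plane.
Variable R : realType.

Definition col2 (x y : R) : 'cV[R]_2 := \col_(i < 2) (if i == 0 then x else y).

Definition dot2 (u v : 'cV[R]_2) : R := \sum_(i < 2) u i 0 * v i 0.

(* The library norm on matrices is the sup norm, hence this definition. *)
Definition norm2 (v : 'cV[R]_2) : R := Num.sqrt (dot2 v v).

Definition perp2 (v : 'cV[R]_2) : 'cV[R]_2 := col2 (v 1 0) (- v 0 0).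

Definition Gmx (gamma dgamma : R -> R) (t : R) : 'M[R]_2 :=
  \matrix_(i < 2, j < 2)
    (if i == 0 then (if j == 0 then gamma t else - dgamma t)
               else (if j == 0 then dgamma t else gamma t)).

End Plane.

(* Elements I_j = [node N j.-1, node N j] are numbered by 1 <= j <= N.  Functions
   on [0, 1] are represented by total functions whose values outside [0, 1] are
   never used. *)

Section FiniteElements.
Variables (R : realType) (N : nat).

Definition node (j : nat) : R := j%:R / N%:R.

Definition Kph (u : R -> R) : Prop :=
  [/\ {within `[0, 1], continuous u},
      forall j, (1 <= j <= N)%N -> exists a b : R,
        forall x, node j.-1 <= x <= node j -> u x = a * x + b &
      u 0 = u 1].

Definition Xph (U : R -> 'cV[R]_2) : Prop :=
  forall i, Kph (fun x => U x i 0).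

Definition edge (X : R -> 'cV[R]_2) (j : nat) : 'cV[R]_2 :=
  X (node j) - X (node j.-1).

(* The number of the element containing x.  A node is attributed to the element
   on its right; this choice has no effect, as elementwise defined functions
   only enter lumped through their one-sided limits at the nodes. *)
Definition element (x : R) : nat := (Num.truncn (N%:R * x)).+1.

Definition normal (X : R -> 'cV[R]_2) (x : R) : 'cV[R]_2 :=
  let h := edge X (element x) in - ((norm2 h)^-1 *: perp2 h).

(* Derivative of f with respect to the arc length of the polygon X. *)
Definition ds (V : lmodType R) (X : R -> 'cV[R]_2) (f : R -> V) (x : R) : V :=
  let j := element x in
  (norm2 (edge X j))^-1 *: (f (node j) - f (node j.-1)).

Definition lumped (X : R -> 'cV[R]_2) (w : R -> R) : R :=
  2^-1 * \sum_(1 <= j < N.+1)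
    norm2 (edge X j) *
    (lim (w x @[x --> (node j)^'-]) + lim (w x @[x --> (node j.-1)^'+])).

Definition ip_scalar (X : R -> 'cV[R]_2) (u v : R -> R) : R :=
  lumped X (fun x => u x * v x).

Definition ip_vector (X : R -> 'cV[R]_2) (u v : R -> 'cV[R]_2) : R :=
  lumped X (fun x => dot2 (u x) (v x)).

(* theta j is the inclination angle of the j-th edge of X.  The edge direction
   (-1, 0) admits both angles - pi and pi, and either is allowed. *)
Definition edge_angles (X : R -> 'cV[R]_2) (theta : nat -> R) : Prop :=
  forall j, (1 <= j <= N)%N ->
    [/\ - pi <= theta j <= pi,
        cos (theta j) = edge X j 0 0 / norm2 (edge X j) &
        sin (theta j) = edge X j 1 0 / norm2 (edge X j)].

(* One time step from X to (X', mu'). *)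
Definition es_pfem_step (gamma dgamma : R -> R) (tau : R)
    (X : R -> 'cV[R]_2) (theta : nat -> R)
    (X' : R -> 'cV[R]_2) (mu' : R -> R) : Prop :=
  (forall phi, Kph phi ->
     ip_vector X (fun x => tau^-1 *: (X' x - X x))
                 (fun x => phi x *: normal X x)
     + ip_scalar X (ds (V := R^o) X mu') (ds (V := R^o) X phi) = 0) /\
  (forall omega, Xph omega ->
     ip_scalar X mu' (fun x => dot2 (normal X x) (omega x))
     - ip_vector X
         (fun x => Gmx gamma dgamma (theta (element x)) *m ds X X' x)
         (ds X omega) = 0).

(* The surface energy of the polygon X with inclination angles theta. *)
Definition energy (gamma : R -> R) (X : R -> 'cV[R]_2) (theta : nat -> R) : R :=
  \sum_(1 <= j < N.+1) norm2 (edge X j) * gamma (theta j).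

End FiniteElements.

(* Main.v *)
Require Import Defs.
From mathcomp Require Import all_boot all_order all_algebra.
From mathcomp Require Import all_classical all_reals all_analysis.
From mathcomp Require Import ring lra.
Import Order.TTheory GRing.Theory Num.Theory.
Import numFieldNormedType.Exports.

Local Open Scope classical_set_scope.
Local Open Scope ring_scope.

(** Both parts of the theorem come from estimates made one Fourier mode, and
    then one edge, at a time.

    Write the l-th mode of [gamma] as [p (l * x)], where
    [p = harmonic_mode a b] has amplitude [r], the square root of
    [a ^+ 2 + b ^+ 2], and let [d = x - y] and [t = l x].  To the gap between
    the two sides of the first inequality, this mode contributes
    [p t (1 - cos d) + f l], where [f k = p t - k p' t sin d - p (t - k d)].
    As a sequence in [k] for fixed [t], [f] starts with [f 0 = 0] and
    [f 1 = p t (1 - cos d)], and its second differences are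
    [2 p (t - (k + 1) d) (1 - cos d)]: hence [`|f l|] is at most
    [l ^ 2 r (1 - cos d)] ([harmonic_mode_remainder]).  The contribution is
    thus at least [- (1 + l ^ 2) r (1 - cos d)], while the constant mode
    contributes [a_0 / 2 (1 - cos d)], so the assumption on the coefficients
    makes the total nonnegative for every partial sum ([trig_sum_stability]).

    To pass to the limit, the differentiated partial sums have to converge to
    [dgamma].  They converge absolutely, and the limit is the derivative of
    [gamma] because the bound on [f l], summed over [l], is a first order
    expansion with an error [O(1 - cos d)] that is the same for all partial
    sums ([fourier_stability]).

    For the energy, test the first equation of the scheme with
    [tau * mu'] and the second one with [X' - X]: the term [(mu', n (X' - X))]
    cancels and leaves [(G ds X', ds (X' - X)) <= 0]
    ([es_pfem_step_dissipation]).  This is a sum over the edges, and the first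
    inequality together with [2 |h| |h'| <= |h| ^ 2 + |h'| ^ 2] bounds each
    term below by the energy gained by that edge ([edge_energy_le]). *)

(** * Remainder of a single Fourier mode *)

(** The bound is attained by [f l = l ^ 2 c], whose first difference is
    [(2 l + 1) c]; it is the first difference that is estimated by induction. *)
Lemma norm_le_sqr_of_second_difference {R : realDomainType} (f : nat -> R) (c : R) :
  f 0%N = 0 -> `|f 1%N| <= c ->
  (forall l, `|f l.+2 - 2 * f l.+1 + f l| <= 2 * c) ->
  forall l, `|f l| <= l%:R ^+ 2 * c.
Proof.
move=> f0 f1 f2.
have fS l : `|f l.+1 - f l| <= (2 * l%:R + 1) * c.
  elim: l => [|l IHl]; first by rewrite f0 subr0 mulr0 add0r mul1r.
  have -> : f l.+2 - f l.+1
    = (f l.+1 - f l) + (f l.+2 - 2 * f l.+1 + f l) by ring.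
  apply: le_trans (ler_normD _ _) _.
  have := f2 l; rewrite -natr1; lra.
elim=> [|l IHl]; first by rewrite f0 normr0 expr2 !mul0r.
have -> : f l.+1 = f l + (f l.+1 - f l) by ring.
apply: le_trans (ler_normD _ _) _.
have := fS l; rewrite -natr1; nra.
Qed.

Definition harmonic_mode {R : realType} (a b x : R) : R := a * cos x + b * sin x.

(** Cauchy-Schwarz, with Lagrange's identity giving the defect as a square. *)
Lemma norm_harmonic_mode {R : realType} (a b x : R) :
  `|harmonic_mode a b x| <= Num.sqrt (a ^+ 2 + b ^+ 2).
Proof.
rewrite -sqrtr_sqr ler_wsqrtr // /harmonic_mode -subr_ge0.
have -> : a ^+ 2 + b ^+ 2 - (a * cos x + b * sin x) ^+ 2
    = (a * sin x - b * cos x) ^+ 2.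
  by rewrite -[X in X - _]mulr1 -(cos2Dsin2 x); ring.
exact: sqr_ge0.
Qed.

(** First order expansion of [x |-> p (l * x)], where [p = harmonic_mode a b] and
    [p' = harmonic_mode b (- a)].  For fixed [t], the linear term drops out of
    the second difference in [l], which is [2 p (t - (l + 1) d) (1 - cos d)];
    having [sin d] instead of [d] in that term is what makes the value at
    [l = 1] equal to [p t (1 - cos d)]. *)
Lemma harmonic_mode_remainder {R : realType} (a b t d : R) (l : nat) :
  `|harmonic_mode a b t - l%:R * harmonic_mode b (- a) t * sin d
    - harmonic_mode a b (t - l%:R * d)|
  <= l%:R ^+ 2 * (Num.sqrt (a ^+ 2 + b ^+ 2) * (1 - cos d)).
Proof.
have cd : 0 <= 1 - cos d by rewrite subr_ge0 cos_le1.
pose p := harmonic_mode a b.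
have bnd x y : 0 <= y -> `|y * (p x * (1 - cos d))|
    <= y * (Num.sqrt (a ^+ 2 + b ^+ 2) * (1 - cos d)).
  move=> y0; rewrite !normrM (ger0_norm cd) (ger0_norm y0).
  by rewrite ler_wpM2l// ler_wpM2r// norm_harmonic_mode.
move: l; apply: norm_le_sqr_of_second_difference.
- by rewrite /= !mul0r !subr0 subrr.
- rewrite !mul1r -[leRHS]mul1r.
  have -> : p t - harmonic_mode b (- a) t * sin d - p (t - d)
     = 1 * (p t * (1 - cos d)).
    by rewrite /p /harmonic_mode cosB sinB; ring.
  exact: bnd.
move=> l; set v := t - l.+1%:R * d.
have l1 : l.+1%:R = l%:R + 1 :> R by rewrite natr1.
have l2 : l.+2%:R = l%:R + 2 :> R by rewrite -natrD addn2.
rewrite [t - l.+2%:R * d](_ : _ = v - d); last by rewrite /v l1 l2; ring.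
rewrite [t - l%:R * d](_ : _ = v + d); last by rewrite /v l1; ring.
rewrite [X in `|X|](_ : _ = 2 * (p v * (1 - cos d))); first exact: bnd.
by rewrite l1 l2 /p /harmonic_mode cosB sinB cosD sinD; ring.
Qed.

(** * Derivatives from remainder bounds *)

Lemma cvg_difference_quotient {R : realType} (f : R -> R) (x df : R) :
  is_derive x 1 f df -> (f y - f x) / (y - x) @[y --> x^'] --> df.
Proof.
case=> fx <-.
have shiftx : y - x @[y --> x^'] --> 0^'.
  rewrite -(subrr x); apply: (continuous_injective_withinNx (f := fun y => y - x)).
    by apply: cvgB => //; exact: cvg_cst.
  by move=> y /eqP; rewrite subr_eq subrK => /eqP.
apply: cvg_trans (cvg_comp _ _ shiftx fx).
apply: near_eq_cvg; near=> y.
by rewrite /= [_ *: 1]mulr1 subrK mulrC.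
Unshelve. all: by end_near. Qed.

(** Needed for the uniqueness of one-sided limits at the endpoints of the
    interval: at least one of the two sides of [x] meets the interval. *)
Lemma within_itv_dnbhs_proper {R : realType} (a b x : R) :
  a < b -> a <= x <= b -> ProperFilter (within `[a, b] x^').
Proof.
move=> ab /andP[ax xb]; apply: Build_ProperFilter.
rewrite /within /dnbhs /within /= => x0.
have [xltb|bx] := ltP x b.
  have [|y /=] := @filter_ex _ (x^'+ : set_system R) _ (fun y => False).
    near=> y; have /= : y != x -> y \in `[a, b] -> False by near: y; exact: cvg_within.
    apply; first by rewrite gt_eqF.
    by rewrite in_itv/= (le_trans ax) //= ltW.
  by [].
have [|y /=] := @filter_ex _ (x^'- : set_system R) _ (fun y => False).
  near=> y; have /= : y != x -> y \in `[a, b] -> False by near: y; exact: cvg_within.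
  apply; first by rewrite lt_eqF.
  rewrite in_itv/= (le_trans _ xb) ?andbT; last exact: ltW.
  by apply: ltW; near: y; apply: nbhs_left_gt; exact: lt_le_trans bx.
by [].
Unshelve. all: by end_near. Qed.

(** The quotient of [f] is within the quotient of [K (1 - cos (x - y))], which
    tends to zero, of the quotient of [s sin (y - x)], which tends to [s]. *)
Lemma cvg_difference_quotient_of_remainder {R : realType} (F : set_system R)
    {FF : Filter F} (K s : R) (f : R -> R) (x : R) :
  F --> x^' ->
  (\forall y \near F,
    `|f x - s * sin (x - y) - f y| <= K * (1 - cos (x - y))) ->
  (f y - f x) / (y - x) @[y --> F] --> s.
Proof.
move=> Fx bnd.
pose g y := - s * sin (x - y); pose k y := K * (1 - cos (x - y)).
have dg : is_derive x 1 g s.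
  by apply: is_derive_eq; rewrite subrr cos0 /GRing.scale /=; ring.
have dk : is_derive x 1 k 0.
  by apply: is_derive_eq; rewrite subrr sin0 /GRing.scale /=; ring.
pose Q (u : R -> R) y := (u y - u x) / (y - x).
have cvgQ (u : R -> R) (l : R) : is_derive x 1 u l -> Q u y @[y --> F] --> l.
  move=> ul; apply: cvg_trans (cvg_difference_quotient _ _ _ ul).
  exact: cvg_app.
have Qk : `|Q k y| @[y --> F] --> 0.
  by have := @cvg_norm _ _ _ F FF _ _ (cvgQ _ _ dk); rewrite normr0.
have Qfg : Q f y - Q g y @[y --> F] --> 0.
  apply: (squeeze_cvgr (f := fun y => - `|Q k y|)
                       (h := fun y => `|Q k y|)) => //; last first.
    by rewrite -oppr0; exact: cvgN.
  apply: filterS bnd => y bndy.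
  rewrite -ler_norml -mulrBl !normrM ler_wpM2r //.
  rewrite /g /k !(subrr x) sin0 cos0 !(subrr 1) !mulr0 !subr0.
  rewrite (_ : _ - _ = - (f x - s * sin (x - y) - f y)); last by ring.
  by rewrite normrN (le_trans bndy) // ler_norm.
rewrite -[s]addr0 (_ : (fun y => _) = Q g \+ (fun y => Q f y - Q g y)).
  exact: cvgD (cvgQ _ _ dg) Qfg.
by apply/funext => y /=; rewrite addrCA subrr addr0.
Qed.

Lemma derivative_on_of_remainder {R : realType} (a b K s : R) (f df : R -> R) (x : R) :
  a < b -> is_derivative_on a b f df -> a <= x <= b ->
  (forall y, a <= y <= b -> `|f x - s * sin (x - y) - f y| <= K * (1 - cos (x - y))) ->
  df x = s.
Proof.
move=> ab fdf xab bnd.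
have FF := within_itv_dnbhs_proper _ _ _ ab xab.
have FF0 : Filter (within `[a, b] x^') by exact: filter_filter.
apply: (@cvg_unique R _ (fmap (fun y => (f y - f x) / (y - x)) (within `[a, b] x^'))
    _) => //.
  exact: fdf.
have wx : within `[a, b] x^' --> x^' by apply: cvg_within.
apply: (cvg_difference_quotient_of_remainder _ K _ _ _ wx).
apply: (@filterS _ x^' _ setT); last exact: filterT.
by move=> y _ yab; apply: bnd; move: yab; rewrite /= in_itv.
Qed.

(** * The stability inequality *)

Section TrigonometricSum.
Variables (R : realType) (c : R) (a b : nat -> R).

Definition amplitude l := Num.sqrt (a l ^+ 2 + b l ^+ 2).

Definition trig_sum n x :=
  c + \sum_(1 <= l < n.+1) harmonic_mode (a l) (b l) (l%:R * x).

Definition trig_sum_slope n x :=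
  \sum_(1 <= l < n.+1) l%:R * harmonic_mode (b l) (- a l) (l%:R * x).

Let mode_remainder x y l :=
  harmonic_mode (a l) (b l) (l%:R * x)
  - l%:R * harmonic_mode (b l) (- a l) (l%:R * x) * sin (x - y)
  - harmonic_mode (a l) (b l) (l%:R * y).

Let norm_mode_remainder x y l :
  `|mode_remainder x y l| <= l%:R ^+ 2 * (amplitude l * (1 - cos (x - y))).
Proof.
rewrite /mode_remainder; have -> : l%:R * y = l%:R * x - l%:R * (x - y) by ring.
exact: harmonic_mode_remainder.
Qed.

Let trig_sum_remainder_sum n x y :
  trig_sum n x - trig_sum_slope n x * sin (x - y) - trig_sum n y
  = \sum_(1 <= l < n.+1) mode_remainder x y l.
Proof.
rewrite /mode_remainder !sumrB -mulr_suml /trig_sum /trig_sum_slope; ring.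
Qed.

Hypothesis coef : forall n,
  \sum_(1 <= l < n.+1) (1 + l%:R ^+ 2) * amplitude l <= c.

(** As the bound does not depend on [n], it survives in the limit. *)
Lemma trig_sum_remainder n x y :
  `|trig_sum n x - trig_sum_slope n x * sin (x - y) - trig_sum n y|
  <= c * (1 - cos (x - y)).
Proof.
have d0 : 0 <= 1 - cos (x - y) by rewrite subr_ge0 cos_le1.
rewrite trig_sum_remainder_sum.
apply: le_trans (ler_norm_sum _ _ _) _.
apply: le_trans (ler_wpM2r d0 (coef n)); rewrite mulr_suml.
apply: ler_sum => l _; apply: le_trans (norm_mode_remainder _ _ _) _.
by rewrite mulrA ler_wpM2r// ler_wpM2r ?sqrtr_ge0// lerDr.
Qed.

Lemma trig_sum_stability n x y :
  trig_sum n y <= 2 * trig_sum n x - trig_sum n x * cos (x - y)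
                  - trig_sum_slope n x * sin (x - y).
Proof.
have d0 : 0 <= 1 - cos (x - y) by rewrite subr_ge0 cos_le1.
rewrite -subr_ge0.
rewrite [X in 0 <= X](_ : _ = c * (1 - cos (x - y)) + \sum_(1 <= l < n.+1)
    (harmonic_mode (a l) (b l) (l%:R * x) * (1 - cos (x - y))
     + mode_remainder x y l)); last first.
  by rewrite big_split/= -trig_sum_remainder_sum -mulr_suml /trig_sum; ring.
apply: le_trans (lerD (ler_wpM2r d0 (coef n)) (lexx _)).
rewrite mulr_suml -big_split/= sumr_ge0// => l _.
have := norm_mode_remainder x y l; rewrite ler_norml => /andP[rl _].
have := norm_harmonic_mode (a l) (b l) (l%:R * x).
rewrite ler_norml -[X in - X <= _]/(amplitude l) => /andP[ml _].
have := ler_wpM2r d0 ml; lra.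
Qed.

(** The terms are at most [l] times the amplitude, and [l <= 1 + l ^ 2]. *)
Lemma is_cvg_trig_sum_slope x : cvgn (trig_sum_slope ^~ x).
Proof.
pose u l : R := l%:R * harmonic_mode (b l) (- a l) (l%:R * x).
pose v l : R := (1 + l%:R ^+ 2) * amplitude l.
have v0 l : 0 <= v l by rewrite mulr_ge0 ?sqrtr_ge0 ?addr_ge0 ?sqr_ge0.
have c0 : 0 <= c by have := coef 0; rewrite big_geq.
have uv l : `|u l| <= v l.
  rewrite normrM ler_pM ?normr_nat//.
    by have := sqr_ge0 (l%:R - 1 : R); have := ler0n R l; nra.
  by rewrite /amplitude addrC -[a l ^+ 2]sqrrN norm_harmonic_mode.
have cu : cvgn (series u).
  apply: normed_cvg; apply: (series_le_cvg _ v0 uv) => [l|].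
    exact: normr_ge0.
  apply: nondecreasing_is_cvgn.
    by apply: nondecreasing_series => *.
  exists (v 0%N + c) => _ [[|n] _ <-]; rewrite /series /=.
    by rewrite big_geq// addr_ge0.
  by rewrite big_ltn// lerD2l; exact: coef.
rewrite -(is_cvg_series_restrict 1) in cu.
by move/cvg_ex : cu => [s us]; apply/cvg_ex; exists s; rewrite -cvg_shiftS in us.
Qed.

End TrigonometricSum.

Lemma fourier_coefficients_bound (R : realType) (gamma : R -> R)
  (Hcoef : (\sum_(1 <= l <oo)
              ((1 + l%:R ^+ 2) *
               Num.sqrt (fourier_cos gamma l ^+ 2 + fourier_sin gamma l ^+ 2))%:E
            <= (fourier_cos gamma 0 / 2)%:E)%E) n :
  \sum_(1 <= l < n.+1) (1 + l%:R ^+ 2) *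
    amplitude _ (fourier_cos gamma) (fourier_sin gamma) l
    <= fourier_cos gamma 0 / 2.
Proof.
rewrite -lee_fin -sumEFin; apply: le_trans Hcoef.
apply: (nneseries_lim_ge (P := xpredT)) => l _ _.
by rewrite lee_fin mulr_ge0 ?sqrtr_ge0 ?addr_ge0 ?sqr_ge0.
Qed.

(** The limit of the differentiated partial sums at [x] is shown to be
    [dgamma x] through the remainder bound between [x] and all other points;
    this includes the endpoints, where [dgamma] is a one-sided derivative. *)
Lemma fourier_stability {R : realType} (gamma dgamma : R -> R) :
  surface_energy gamma dgamma ->
  has_fourier_expansion gamma ->
  (forall n, \sum_(1 <= l < n.+1) (1 + l%:R ^+ 2) *
     amplitude _ (fourier_cos gamma) (fourier_sin gamma) l
     <= fourier_cos gamma 0 / 2) ->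
  forall x y, - pi <= x <= pi -> - pi <= y <= pi ->
  gamma y <= 2 * gamma x - gamma x * cos (x - y) - dgamma x * sin (x - y).
Proof.
move=> [_ dgammaP _ _] expansion coef x y xpi ypi.
set c := fourier_cos gamma 0 / 2 in coef.
pose T := trig_sum _ c (fourier_cos gamma) (fourier_sin gamma).
pose S := trig_sum_slope _ (fourier_cos gamma) (fourier_sin gamma).
have Tcvg z : - pi <= z <= pi -> T n z @[n --> \oo] --> gamma z.
  exact: expansion.
have /cvg_ex[s Scvg] : cvgn (S ^~ x) by exact: is_cvg_trig_sum_slope coef x.
have -> : dgamma x = s.
  apply: (derivative_on_of_remainder _ _ c _ gamma dgamma _ _ dgammaP xpi).
    by have := pi_gt0 R; lra.
  move=> z zpi.
  have lim_remainder :
      `|T n x - S n x * sin (x - z) - T n z| @[n --> \oo]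
      --> `|gamma x - s * sin (x - z) - gamma z|.
    apply: cvg_norm; apply: cvgB; last exact: Tcvg.
    by apply: cvgB; [exact: Tcvg | apply: cvgMr_tmp].
  apply: (cvgr_to_le lim_remainder); apply: nearW => n.
  exact: trig_sum_remainder.
have lim_rhs :
    2 * T n x - T n x * cos (x - y) - S n x * sin (x - y) - T n y @[n --> \oo]
    --> 2 * gamma x - gamma x * cos (x - y) - s * sin (x - y) - gamma y.
  apply: cvgB; last exact: Tcvg.
  apply: cvgB; last exact: cvgMr_tmp.
  by apply: cvgB; [apply: cvgMl_tmp|apply: cvgMr_tmp]; exact: Tcvg.
rewrite -subr_ge0; apply: (cvgr_to_ge lim_rhs); apply: nearW => n.
by rewrite subr_ge0; exact: trig_sum_stability.
Qed.

(** * Mass lumping on the mesh *)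

Section Mesh.
Variables (R : realType) (N : nat).
Hypothesis N_gt0 : (0 < N)%N.

Lemma node_lt j : (1 <= j)%N -> node R N j.-1 < node R N j.
Proof.
by move=> j0; rewrite /node ltr_pM2r ?invr_gt0 ?ltr0n// ltr_nat prednK.
Qed.

Lemma element_interior j x : (1 <= j)%N ->
  node R N j.-1 < x < node R N j -> element N x = j.
Proof.
move=> j0 /andP[lo hi]; have N0 : 0 < N%:R :> R by rewrite ltr0n.
rewrite /element -[RHS]prednK//; congr _.+1; apply/eqP.
rewrite /node ltr_pdivrMr// in lo; rewrite /node ltr_pdivlMr// in hi.
rewrite truncn_eq ?prednK// mulrC; first by rewrite (ltW lo).
by apply: le_trans (ltW lo); exact: ler0n.
Qed.

(** The one-sided limits at the two ends of an element only see its interior,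
    so both of them equal the value on that element. *)
Lemma lumped_elementwise (X : R -> 'cV[R]_2) (g : nat -> R) :
  lumped N X (fun x => g (element N x))
  = \sum_(1 <= j < N.+1) norm2 (edge N X j) * g j.
Proof.
rewrite /lumped mulr_sumr; apply: eq_big_nat => j /andP[j0 _].
have nj := node_lt _ j0.
have -> : lim (g (element N x) @[x --> (node R N j)^'-]) = g j.
  apply: cvg_lim => //; apply: cvg_near_cst; near=> x.
  by rewrite (element_interior j)//; apply/andP; split; near: x;
     [exact: nbhs_left_gt|exact: nbhs_left_lt].
have -> : lim (g (element N x) @[x --> (node R N j.-1)^'+]) = g j.
  apply: cvg_lim => //; apply: cvg_near_cst; near=> x.
  by rewrite (element_interior j)//; apply/andP; split; near: x;
     [exact: nbhs_right_gt|exact: nbhs_right_lt].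
by field.
Unshelve. all: by end_near. Qed.

Lemma Kph_scale (k : R) (u : R -> R) : Kph N u -> Kph N (fun x => k * u x).
Proof.
move=> [cu au pu]; split; last by rewrite pu.
  by move=> x; apply: cvgMl_tmp; exact: cu.
move=> j /au[a [b uab]]; exists (k * a), (k * b) => x /uab ->; ring.
Qed.

Lemma Kph_sub (u v : R -> R) : Kph N u -> Kph N v -> Kph N (fun x => u x - v x).
Proof.
move=> [cu au pu] [cv av pv]; split; last by rewrite pu pv.
  by move=> x; apply: cvgB; [exact: cu|exact: cv].
move=> j jN; have [a [b uab]] := au _ jN; have [a' [b' vab]] := av _ jN.
by exists (a - a'), (b - b') => x xj; rewrite uab// vab//; ring.
Qed.

End Mesh.

(** * Energy balance *)

Lemma dot2E {R : realType} (u v : 'cV[R]_2) :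
  dot2 u v = u 0 0 * v 0 0 + u 1 0 * v 1 0.
Proof.
by rewrite /dot2 big_ord_recl big_ord1; congr (_ + _ * _);
   congr (_ _ _); apply/val_inj.
Qed.

Lemma norm2_gt0 {R : realType} (v : 'cV[R]_2) : v != 0 -> 0 < norm2 v.
Proof.
move=> v0; rewrite sqrtr_gt0 dot2E lt_def addr_ge0 -?expr2 ?sqr_ge0// andbT.
apply: contra v0; rewrite paddr_eq0 ?sqr_ge0// !sqrf_eq0 => /andP[/eqP v0 /eqP v1].
apply/eqP/matrixP => i j; rewrite mxE ord1.
case: i => -[|[|//]] p; [rewrite -[RHS]v0|rewrite -[RHS]v1];
  by congr (v _ _); apply/val_inj.
Qed.

(** In polar coordinates for [h] and [h'], the right-hand side is
    [|h'| ^ 2 gamma t / |h| - |h'| (gamma t cos (t - t') + dgamma t sin (t - t'))].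
    The last hypothesis bounds the bracket by [2 gamma t - gamma t'], and what
    remains, multiplied by [|h|], is [gamma t (|h'| - |h|) ^ 2 >= 0]. *)
Lemma edge_energy_le {R : realType} (t t' : R) (gamma dgamma : R -> R) (h h' : 'cV[R]_2) :
  h != 0 -> h' != 0 -> 0 <= gamma t ->
  cos t = h 0 0 / norm2 h -> sin t = h 1 0 / norm2 h ->
  cos t' = h' 0 0 / norm2 h' -> sin t' = h' 1 0 / norm2 h' ->
  gamma t' <= 2 * gamma t - gamma t * cos (t - t') - dgamma t * sin (t - t') ->
  norm2 h' * gamma t' - norm2 h * gamma t <=
    norm2 h * dot2 (Gmx gamma dgamma t *m ((norm2 h)^-1 *: h'))
                   ((norm2 h)^-1 *: (h' - h)).
Proof.
move=> h0 h'0 g0 ct st ct' st' stab.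
have n0 := norm2_gt0 _ h0; have n'0 := norm2_gt0 _ h'0.
set r := norm2 h in ct st n0 *; set r' := norm2 h' in ct' st' n'0 *.
have rD : r != 0 by rewrite gt_eqF.
have r'D : r' != 0 by rewrite gt_eqF.
have h0E : h 0 0 = r * cos t by rewrite ct mulrC divfK.
have h1E : h 1 0 = r * sin t by rewrite st mulrC divfK.
have h'0E : h' 0 0 = r' * cos t' by rewrite ct' mulrC divfK.
have h'1E : h' 1 0 = r' * sin t' by rewrite st' mulrC divfK.
have cs : cos t' ^+ 2 + sin t' ^+ 2 = 1 := cos2Dsin2 t'.
have -> : r * dot2 (Gmx gamma dgamma t *m (r^-1 *: h')) (r^-1 *: (h' - h))
   = r^-1 * (gamma t * r' ^+ 2
       - r * r' * (gamma t * cos (t - t') + dgamma t * sin (t - t'))).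
  rewrite dot2E !mxE !big_ord_recl !big_ord0 !mxE /=.
  have -> : lift ord0 ord0 = 1 :> 'I_2 by apply/val_inj.
  have -> : ord0 = 0 :> 'I_2 by apply/val_inj.
  rewrite /= h0E h1E h'0E h'1E cosB sinB.
  rewrite -[r' ^+ 2]mulr1 -cs; field.
  exact: rD.
rewrite -ler_pdivrMl ?invr_gt0// invrK.
have := ler_wpM2l (ltW (mulr_gt0 n0 n'0)) stab.
have := mulr_ge0 g0 (sqr_ge0 (r' - r)).
nra.
Qed.

(** The left-hand side is [(G ds X', ds (X' - X))]; the scheme makes it equal to
    [- tau (ds mu, ds mu)]. *)
Lemma es_pfem_step_dissipation {R : realType} (N : nat) (gamma dgamma : R -> R) (tau : R)
    (X X' : R -> 'cV[R]_2) (mu : R -> R) (theta : nat -> R) :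
  (0 < N)%N -> 0 < tau -> Xph N X -> Xph N X' -> Kph N mu ->
  es_pfem_step N gamma dgamma tau X theta X' mu ->
  \sum_(1 <= j < N.+1) norm2 (edge N X j) *
    dot2 (Gmx gamma dgamma (theta j) *m ((norm2 (edge N X j))^-1 *: edge N X' j))
         ((norm2 (edge N X j))^-1 *: (edge N X' j - edge N X j)) <= 0.
Proof.
move=> N0 tau0 KX KX' Kmu [eq_mu eq_X].
have KD : Xph N (fun x => X' x - X x).
  move=> i; have := Kph_sub _ _ _ _ (KX' i) (KX i).
  by congr Kph; apply/funext => x; rewrite !mxE.
(* The factor tau absorbs the tau^-1 of the time difference quotient, so the
   first integrand becomes literally that of the second equation; no limit of
   mu * (n . (X' - X)) at the nodes has to be computed. *)
have := eq_X _ KD; have := eq_mu _ (Kph_scale _ _ tau _ Kmu).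
pose D j := edge N X' j - edge N X j.
pose dmu j := (norm2 (edge N X j))^-1 * (mu (node R N j) - mu (node R N j.-1)).
rewrite [ip_vector _ _ _ (ds _ _ _)](_ : _ = \sum_(1 <= j < N.+1) norm2 (edge N X j) *
    dot2 (Gmx gamma dgamma (theta j) *m ((norm2 (edge N X j))^-1 *: edge N X' j))
         ((norm2 (edge N X j))^-1 *: D j)); last first.
  rewrite -(lumped_elementwise _ _ N0); congr lumped; apply/funext => x.
  by rewrite /ds /D /edge; congr (dot2 _ (_ *: _)); rewrite !opprD !opprK addrACA.
rewrite [ip_scalar _ _ (ds _ _ _) _](_ : _ = \sum_(1 <= j < N.+1)
    norm2 (edge N X j) * (tau * dmu j ^+ 2)); last first.
  rewrite -(lumped_elementwise _ _ N0); congr lumped; apply/funext => x.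
  by rewrite /ds /dmu /GRing.scale /=; ring.
rewrite [ip_vector _ _ _ (fun x => _ *: normal _ _ x)](_ : _ =
   ip_scalar N X mu (fun x => dot2 (normal N X x) (X' x - X x))); last first.
  congr lumped; apply/funext => x.
  move: (normal N X x) => n; rewrite !dot2E !mxE; field.
  by rewrite gt_eqF.
set A := ip_scalar _ _ _ _; set B := \sum_(1 <= j < N.+1) _ * (tau * _).
have : 0 <= B.
  by apply: sumr_ge0 => j _; rewrite mulr_ge0 ?sqrtr_ge0// mulr_ge0 ?sqr_ge0// ltW.
lra.
Qed.

Lemma energy_step_le {R : realType} (N : nat) (gamma dgamma : R -> R) (tau : R)
    (X X' : R -> 'cV[R]_2) (mu : R -> R) (theta theta' : nat -> R) :
  (forall x, - pi <= x <= pi -> 0 <= gamma x) ->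
  (forall x y, - pi <= x <= pi -> - pi <= y <= pi ->
    gamma y <= 2 * gamma x - gamma x * cos (x - y) - dgamma x * sin (x - y)) ->
  (0 < N)%N -> 0 < tau -> Xph N X -> Xph N X' -> Kph N mu ->
  (forall j, (1 <= j <= N)%N -> edge N X j != 0) ->
  (forall j, (1 <= j <= N)%N -> edge N X' j != 0) ->
  edge_angles N X theta -> edge_angles N X' theta' ->
  es_pfem_step N gamma dgamma tau X theta X' mu ->
  energy N gamma X' theta' <= energy N gamma X theta.
Proof.
move=> gamma0 stab N0 tau0 KX KX' Kmu X0 X'0 Xtheta X'theta step.
rewrite -subr_le0 -sumrB.
apply: le_trans (es_pfem_step_dissipation _ _ _ _ _ _ _ _ N0 tau0 KX KX' Kmu step).
apply: ler_sum_nat => j jN.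
have [tpi ct st] := Xtheta _ jN; have [t'pi ct' st'] := X'theta _ jN.
by apply: edge_energy_le => //; [exact: X0|exact: X'0|exact: gamma0|exact: stab].
Qed.

Theorem theorem4p3 (R : realType) (gamma dgamma : R -> R)
  (Hgamma : surface_energy gamma dgamma)
  (Hfourier : has_fourier_expansion gamma)
  (Hcoef : (\sum_(1 <= l <oo)
              ((1 + l%:R ^+ 2) *
               Num.sqrt (fourier_cos gamma l ^+ 2 + fourier_sin gamma l ^+ 2))%:E
            <= (fourier_cos gamma 0 / 2)%:E)%E) :
  (forall theta phi : R, - pi <= theta <= pi -> - pi <= phi <= pi ->
     2 * gamma theta - gamma theta * cos (theta - phi)
       - dgamma theta * sin (theta - phi) >= gamma phi)
  /\
  (forall (N : nat) (tau : R) (X : nat -> R -> 'cV[R]_2) (mu : nat -> R -> R)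
          (theta : nat -> nat -> R),
     (3 <= N)%N ->
     0 < tau ->
     (forall m, Xph N (X m)) ->
     (forall m, Kph N (mu m.+1)) ->
     (forall m j, (1 <= j <= N)%N -> edge N (X m) j != 0) ->
     (forall m, edge_angles N (X m) (theta m)) ->
     (forall m, es_pfem_step N gamma dgamma tau
                  (X m) (theta m) (X m.+1) (mu m.+1)) ->
     forall m, energy N gamma (X m.+1) (theta m.+1)
                 <= energy N gamma (X m) (theta m)
               <= energy N gamma (X 0%N) (theta 0%N)).
Proof.
have stab := fourier_stability _ _ Hgamma Hfourier
  (fourier_coefficients_bound _ _ Hcoef).
split=> [//|N tau X mu theta N3 tau0 KX Kmu X0 Xtheta step].
have N0 : (0 < N)%N by exact: leq_trans N3.
have [gamma_gt0 _ _ _] := Hgamma.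
have decr m : energy N gamma (X m.+1) (theta m.+1) <= energy N gamma (X m) (theta m).
  apply: (energy_step_le _ _ _ _ _ _ (mu m.+1) _ _ _ stab N0 tau0) => //.
  - by move=> x xpi; apply: ltW; exact: gamma_gt0.
  - exact: X0.
  - exact: X0.
move=> m; rewrite decr /=; elim: m => [//|k IHk].
exact: le_trans (decr k) IHk.
Qed.
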